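(* Let $q=2^m$ for some positive integer $m$, let $h$ be a positive integer with $\gcd(h,q-1)=1$, and let $f(x)=x^h\in\mathbb{F}_q[x]$. Then $f(x)$ is an $o$-polynomial if and only if $S_{h-2}(\beta_1,\beta_2,\beta_3)\ne0$ for all pairwise distinct $\beta_1,\beta_2,\beta_3\in\mathbb{F}_q$.
   Context: For an integer $t\ge 0$, $S_t(x_1,x_2,x_3)=\sum_{t_1+t_2+t_3=t,\ t_i\ge0}x_1^{t_1}x_2^{t_2}x_3^{t_3}$ is the complete symmetric polynomial of degree $t$ (so $S_0=1$); by convention $S_t=0$ for $t<0$. A hyperoval in $\mathrm{PG}(2,q)$ is a $(q+2)$-arc, i.e. a set of $q+2$ points no three of which are collinear. A polynomial $f(x)\in\mathbb{F}_q[x]$ is called an $o$-polynomial if $$D(f)=\{(1:x:f(x)) : x\in\mathbb{F}_q\}\cup\{(0:1:0),(0:0:1)\}$$ is a hyperoval in $\mathrm{PG}(2,q)$. *)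

(* Defs.v *)
From HB Require Import structures.
From mathcomp Require Import all_boot all_order all_algebra all_field.
From mathcomp Require Import finmap.

Set Implicit Arguments.
Unset Strict Implicit.
Unset Printing Implicit Defensive.
Import GRing.Theory.
Local Open Scope fset_scope.
Local Open Scope ring_scope.

(* S_t(x1, x2, x3), indexed by an integer so that S_t = 0 for t < 0. *)
Definition complete_sym (R : comNzRingType) (t : int) (x1 x2 x3 : R) : R :=
  match t with
  | Posz n =>
      \sum_(t1 < n.+1) \sum_(t2 < n.+1) \sum_(t3 < n.+1 | (t1 + t2 + t3 == n)%N)
        x1 ^+ t1 * x2 ^+ t2 * x3 ^+ t3
  | Negz _ => 0
  end.

Section ProjectivePlane.
Variable F : finFieldType.

(* The points (resp. lines) of PG(2, q) are the 1-dimensional (resp.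
   2-dimensional) subspaces of F^3; incidence is inclusion. *)
Definition pg2_point (P : {vspace 'rV[F]_3}) : bool := \dim P == 1%N.
Definition pg2_line (L : {vspace 'rV[F]_3}) : bool := \dim L == 2%N.

Definition collinear (P Q R : {vspace 'rV[F]_3}) : Prop :=
  exists L : {vspace 'rV[F]_3},
    [/\ pg2_line L, (P <= L)%VS, (Q <= L)%VS & (R <= L)%VS].

Definition is_arc (k : nat) (A : {fset {vspace 'rV[F]_3}}) : Prop :=
  [/\ forall P, P \in A -> pg2_point P,
      #|` A| = k
    & forall P Q R, P \in A -> Q \in A -> R \in A ->
        P != Q -> P != R -> Q != R -> ~ collinear P Q R].

Definition is_hyperoval (A : {fset {vspace 'rV[F]_3}}) : Prop :=
  is_arc (#|F| + 2) A.

(* (a : b : c); a point only when (a, b, c) is nonzero. *)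
Definition homog (a b c : F) : {vspace 'rV[F]_3} :=
  <[\row_(i < 3) [:: a; b; c]`_i]>%VS.

Definition opoly_set (f : {poly F}) : {fset {vspace 'rV[F]_3}} :=
  [fset homog 1 x f.[x] | x in F] `|` [fset homog 0 1 0; homog 0 0 1].

Definition is_opoly (f : {poly F}) : Prop := is_hyperoval (opoly_set f).

End ProjectivePlane.

(* Main.v *)
(** Expanding S_{h-2} twice by the geometric-sum formula gives
    (x - y)(x - z)(y - z) S_{h-2}(x, y, z) = - det [1 x x^h; 1 y y^h; 1 z z^h],
    so for distinct x, y, z the value of S_{h-2} decides whether the three affine
    points of D(x^h) with these parameters are collinear. The determinants of
    triples meeting the line at infinity are, up to sign, y - x, f(y) - f(x)
    or 1, and they never vanish because x |-> x^h is injective when h is prime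
    to q - 1. Characteristic 2 plays no role. *)
Require Import Defs.
From mathcomp Require Import all_boot all_order all_algebra all_field.
From mathcomp Require Import finmap ring zify.

Set Implicit Arguments.
Unset Strict Implicit.
Unset Printing Implicit Defensive.
Import GRing.Theory.
Local Open Scope ring_scope.

(* With [k] the exponent of [x], this sums the part of [complete_sym] in [y], [z]. *)
Lemma subrXX_partition (R : comNzRingType) (n k : nat) (y z : R) : (k <= n)%N ->
  (y - z) * (\sum_(i < n.+1) \sum_(j < n.+1 | (k + i + j == n)%N) y ^+ i * z ^+ j)
  = y ^+ (n - k).+1 - z ^+ (n - k).+1.
Proof.
(* The sign is flipped before factoring so that the index of the geometric sum becomes the exponent
   of [y]. *)
move=> le_kn; rewrite -[RHS]opprB subrXX -mulNr opprB; congr (_ * _).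
have le_nk : ((n - k).+1 <= n.+1)%N by lia.
rewrite (big_ord_widen _ (fun i => z ^+ ((n - k).+1.-1 - i) * y ^+ i) le_nk).
rewrite [RHS]big_mkcond; apply: eq_bigr => i _.
(* Only [j = n - k - i] satisfies the constraint, and no [j] does once [i > n - k]. *)
case: ifPn => [lt_i | ge_i]; last by rewrite big_pred0 // => j; lia.
have lt_j : (n - k - i < n.+1)%N by lia.
rewrite (big_pred1 (Ordinal lt_j)) => [|j] /=; first by rewrite mulrC.
by rewrite -val_eqE /=; lia.
Qed.

(** The 3 by 3 determinant by rows, expanded along the first row so that [ring] can handle it. *)
Definition det3 (R : comNzRingType) (a b c d e f g h i : R) : R :=
  a * (e * i - f * h) - b * (d * i - f * g) + c * (d * h - e * g).

Lemma vandermonde_complete_sym (R : comNzRingType) (n : nat) (x y z : R) :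
  (x - y) * (x - z) * (y - z) * complete_sym n%:Z x y z
  = - det3 1 x (x ^+ n.+2) 1 y (y ^+ n.+2) 1 z (z ^+ n.+2).
Proof.
(* The factor [y - z] collapses the inner sums to [y ^+ (n - i).+1 - z ^+ (n - i).+1]; what remains
   is one geometric sum in [x], [y] and one in [x], [z], absorbed by the other two factors. *)
have -> : (x - y) * (x - z) * (y - z) * complete_sym n%:Z x y z =
    y * (x - z) * ((x - y) * \sum_(t < n.+1) x ^+ (n.+1.-1 - t) * y ^+ t)
    - z * (x - y) * ((x - z) * \sum_(t < n.+1) x ^+ (n.+1.-1 - t) * z ^+ t).
  have -> : complete_sym n%:Z x y z =
      \sum_(i < n.+1) x ^+ i * \sum_(j < n.+1)
        \sum_(k < n.+1 | (i + j + k == n)%N) y ^+ j * z ^+ k.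
    apply: eq_bigr => i _; rewrite mulr_sumr; apply: eq_bigr => j _.
    by rewrite mulr_sumr; apply: eq_bigr => k _; rewrite mulrA.
  rewrite -mulrA (mulr_sumr _ _ _ (y - z)).
  under eq_bigr => i _ do rewrite mulrCA subrXX_partition -1?ltnS // mulrBr.
  rewrite sumrB.
  have rev_sum w : \sum_(i < n.+1) x ^+ i * w ^+ (n - i).+1 =
      w * \sum_(i < n.+1) x ^+ (n.+1.-1 - i) * w ^+ i.
    rewrite (reindex_inj rev_ord_inj) mulr_sumr; apply: eq_bigr => i _ /=.
    by rewrite subSS subKn -1?ltnS // exprS mulrCA.
  by rewrite !rev_sum; ring.
by rewrite -!subrXX /det3 !exprS; ring.
Qed.

Lemma complete_sym_neq0 (K : fieldType) (h : nat) (x y z : K) :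
  (0 < h)%N -> x != y -> x != z -> y != z ->
  (complete_sym (h%:Z - 2) x y z != 0)
  = (det3 1 x (x ^+ h) 1 y (y ^+ h) 1 z (z ^+ h) != 0).
Proof.
rewrite -(subr_eq0 x y) -(subr_eq0 x z) -(subr_eq0 y z).
case: h => [|[|n]] // _ xy xz yz.
  (* [h = 1]: the index is [-1], and the determinant has two equal columns. *)
  by rewrite /= /det3 !expr1 !eqxx; congr (~~ _); symmetry; apply/eqP; ring.
have -> : n.+2%:Z - 2 = n%:Z by lia.
rewrite -[X in _ = (X != 0)]opprK -vandermonde_complete_sym oppr_eq0.
by rewrite !mulf_eq0 (negPf xy) (negPf xz) (negPf yz).
Qed.

Section Plane.
Variable F : finFieldType.
Implicit Types (a b c x y z : F) (L : {vspace 'rV[F]_3}).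

Definition hvec a b c : 'rV[F]_3 := \row_(i < 3) [:: a; b; c]`_i.

Lemma hvec_inj a b c a' b' c' :
  hvec a b c = hvec a' b' c' -> [/\ a = a', b = b' & c = c'].
Proof.
move=> /rowP E; move: (E 0) (E 1) (E (inord 2)).
by rewrite !mxE /= !inordK.
Qed.

Lemma hvecP (v : 'rV[F]_3) : exists a b c, v = hvec a b c.
Proof.
exists (v 0 0), (v 0 1), (v 0 (inord 2)); apply/rowP => i; rewrite mxE.
by case: i => [[|[|[|i]]]] //= lti; congr (v 0 _); apply/val_inj; rewrite /= ?inordK.
Qed.

Lemma hvec_lin k l a b c a' b' c' :
  k *: hvec a b c + l *: hvec a' b' c' =
  hvec (k * a + l * a') (k * b + l * b') (k * c + l * c').
Proof. by apply/rowP => -[[|[|[|i]]]] // lti; rewrite !mxE. Qed.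

Lemma hvec_scale k a b c : k *: hvec a b c = hvec (k * a) (k * b) (k * c).
Proof. by apply/rowP => -[[|[|[|i]]]] // lti; rewrite !mxE. Qed.

Lemma homog_eq_scale a b c a' b' c' : homog a b c = homog a' b' c' ->
  exists k, [/\ a = k * a', b = k * b' & c = k * c'].
Proof.
move=> E; have : hvec a b c \in homog a' b' c' by rewrite -E memv_line.
by move=> /vlineP[k]; rewrite hvec_scale => /hvec_inj; exists k.
Qed.

Lemma homog_point a b c : (a != 0) || (b != 0) || (c != 0) ->
  pg2_point (homog a b c).
Proof.
rewrite /pg2_point dim_vline eqb1; apply: contraTneq => E.
have [-> -> ->] : [/\ a = 0, b = 0 & c = 0].
  apply: hvec_inj; rewrite [LHS]E; apply/rowP => i; rewrite !mxE.
  by case: i => [[|[|[|i]]]].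
by rewrite eqxx.
Qed.

(** All three rows are combinations of the same two vectors spanning the line, so the determinant
    vanishes identically in the coefficients. *)
Lemma collinear_det3 a b c a' b' c' a'' b'' c'' :
  collinear (homog a b c) (homog a' b' c') (homog a'' b'' c'') ->
  det3 a b c a' b' c' a'' b'' c'' = 0.
Proof.
case=> L [/eqP dimL]; rewrite -!memvE.
have [e [f LP]] : exists e f, forall v, v \in L -> exists k l, v = k *: e + l *: f.
  exists (vbasis L)`_0, (vbasis L)`_1 => v /coord_vbasis ->.
  (* The type of the basis depends on [\dim L], so both are generalized before the dimension is
     replaced by 2. *)
  move: (vbasis L) => X; move: (\dim L) dimL X => _ -> X.
  rewrite !big_ord_recl big_ord0 addr0.
  by exists (coord X 0 v), (coord X (lift ord0 ord0) v).
have [[e1 [e2 [e3 eE]]] [f1 [f2 [f3 fE]]]] := (hvecP e, hvecP f).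
rewrite {}eE {}fE in LP; move=> /LP[k [l]]; rewrite hvec_lin => /hvec_inj[-> -> ->].
move=> /LP[k' [l']]; rewrite hvec_lin => /hvec_inj[-> -> ->].
move=> /LP[k'' [l'']]; rewrite hvec_lin => /hvec_inj[-> -> ->].
by rewrite /det3; ring.
Qed.

Lemma det3_collinear x y z a b c : x != y ->
  det3 1 x a 1 y b 1 z c = 0 ->
  collinear (homog 1 x a) (homog 1 y b) (homog 1 z c).
Proof.
move=> xy D; have xy0 : x - y != 0 by rewrite subr_eq0.
exists (homog 1%R x a + homog 1%R y b)%VS; split.
- rewrite /pg2_line dimv_disjoint_sum; last first.
    (* A common vector has coefficients [k = l] by the first coordinate, then [k * x = k * y] forces
       [k = 0]. *)
    apply/eqP; rewrite -subv0; apply/subvP => v /memv_capP[].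
    move=> /vlineP[k ->] /vlineP[l]; rewrite -!/(hvec _ _ _) !hvec_scale.
    move=> /hvec_inj[]; rewrite !mulr1 => <- kxy _.
    have -> : k = 0.
      by apply/eqP; apply: contraNT xy => k0; apply/eqP; apply: (mulfI k0).
    by apply/vlineP; exists 0; apply/rowP => -[[|[|[|i]]]] // lti; rewrite !mxE !mul0r.
  have pt (t u : F) : pg2_point (homog 1 t u) by rewrite homog_point ?oner_eq0.
  by rewrite (eqP (pt x a)) (eqP (pt y b)).
- exact: addvSl.
- exact: addvSr.
rewrite -memvE; apply/memv_addP.
(* The coefficients interpolate at [x] and [y]; the third coordinate follows from [D]. *)
exists (((z - y) / (x - y)) *: hvec 1 x a); first exact/memvZ/memv_line.
exists (((x - z) / (x - y)) *: hvec 1 y b); first exact/memvZ/memv_line.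
rewrite hvec_lin -/(hvec _ _ _); congr hvec; try by field.
(* In the determinant [c] has coefficient [y - x], so this subtraction of zero eliminates [c]. *)
have -> : c = c - det3 1 x a 1 y b 1 z c / (y - x) by rewrite D mul0r subr0.
by rewrite /det3; field; rewrite xy0 -oppr_eq0 opprB.
Qed.

Lemma opoly_setP (f : {poly F}) P :
  reflect ([\/ exists x, P = homog 1 x f.[x], P = homog 0 1 0 | P = homog 0 0 1])
    (P \in opoly_set f).
Proof.
rewrite /opoly_set !inE; apply: (iffP idP) => [/or3P[] | []].
- by case/imfsetP => x _ ->; constructor 1; exists x.
- by move/eqP; constructor 2.
- by move/eqP; constructor 3.
- by case=> x ->; apply/orP; left; apply/imfsetP; exists x.
- by move->; rewrite eqxx orbT.
- by move->; rewrite eqxx !orbT.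
Qed.

Lemma homog_affine_inj x y a b : homog 1 x a = homog 1 y b -> x = y.
Proof. by move=> /homog_eq_scale[k []]; rewrite mulr1 => <-; rewrite mul1r. Qed.

(** The second coordinate separates the affine points; the first keeps them apart from the two
    points at infinity. *)
Lemma card_opoly_set (f : {poly F}) : #|` opoly_set f|%fset = (#|F| + 2)%N.
Proof.
have neq_inf : homog 0 1 0 != homog 0 0 1 :> {vspace 'rV[F]_3}.
  apply/eqP => /homog_eq_scale[k [_ /eqP]].
  by rewrite mulr0 oner_eq0.
have affine_inf x y b c : homog 1 x y <> homog 0 b c.
  by move=> /homog_eq_scale[k [/eqP]]; rewrite mulr0 oner_eq0.
rewrite /opoly_set cardfsU cardfs2 neq_inf card_imfset => [|x y]; last first.
  exact: homog_affine_inj.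
rewrite -cardE -[RHS]subn0; congr (_ - _)%N.
apply/eqP; rewrite cardfs_eq0; apply/eqP/fsetP => P; rewrite !inE.
apply/negP => /andP[/imfsetP[x _ ->]] /orP[] /eqP; exact: affine_inf.
Qed.

Lemma is_opolyP (f : {poly F}) : injective (horner f) ->
  is_opoly f <->
  (forall x y z, x != y -> x != z -> y != z ->
     det3 1 x f.[x] 1 y f.[y] 1 z f.[z] != 0).
Proof.
move=> f_inj; split=> [[_ _ arc] x y z xy xz yz | det_neq0].
  have pt t : homog 1 t f.[t] \in opoly_set f.
    by apply/opoly_setP; constructor 1; exists t.
  have neq s t : s != t -> homog 1 s f.[s] != homog 1 t f.[t].
    by apply: contra_neq => /homog_affine_inj.
  apply/eqP => det0; apply: (arc _ _ _ (pt x) (pt y) (pt z)); try exact: neq.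
  exact: det3_collinear.
split; last 1 first.
- have neq s t : homog 1 s f.[s] != homog 1 t f.[t] -> s <> t.
    by move=> /eqP st E; case: st; rewrite E.
  (* A determinant involving a point at infinity is a difference up to sign; the disjunction absorbs
     the sign. *)
  have sub0_eq (s t d : F) : d = 0 -> s - t = d \/ t - s = d -> s = t.
    by move=> -> [] /eqP; rewrite subr_eq0 => /eqP.
  have one_neq0 : (1 : F) <> 0 by apply/eqP; exact: oner_neq0.
  move=> P Q R P_in Q_in R_in PQ PR QR.
  (* Of the 27 cases, those repeating a point at infinity contradict distinctness; 13 remain. *)
  case/opoly_setP: P_in PQ PR => [[x] | |] ->;
  case/opoly_setP: Q_in QR => [[y] | |] ->;
  case/opoly_setP: R_in => [[z] | |] ->;
  rewrite ?eqxx // => QR PQ PR /collinear_det3 D.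
  + by move/eqP: D; apply/negP/det_neq0; apply/eqP; exact: neq.
  + by apply: (neq _ _ PQ); apply/f_inj/(sub0_eq _ _ _ D); left; rewrite /det3; ring.
  + by apply: (neq _ _ PQ); apply/(sub0_eq _ _ _ D); right; rewrite /det3; ring.
  + by apply: (neq _ _ PR); apply/f_inj/(sub0_eq _ _ _ D); right; rewrite /det3; ring.
  + by apply: one_neq0; apply: (sub0_eq _ _ _ D); left; rewrite /det3; ring.
  + by apply: (neq _ _ PR); apply/(sub0_eq _ _ _ D); left; rewrite /det3; ring.
  + by apply: one_neq0; apply: (sub0_eq _ _ _ D); right; rewrite /det3; ring.
  + by apply: (neq _ _ QR); apply/f_inj/(sub0_eq _ _ _ D); left; rewrite /det3; ring.
  + by apply: one_neq0; apply: (sub0_eq _ _ _ D); right; rewrite /det3; ring.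
  + by apply: one_neq0; apply: (sub0_eq _ _ _ D); left; rewrite /det3; ring.
  + by apply: (neq _ _ QR); apply/(sub0_eq _ _ _ D); right; rewrite /det3; ring.
  + by apply: one_neq0; apply: (sub0_eq _ _ _ D); left; rewrite /det3; ring.
  + by apply: one_neq0; apply: (sub0_eq _ _ _ D); right; rewrite /det3; ring.
- by move=> P /opoly_setP[[x]| |] ->; apply: homog_point; rewrite oner_eq0 ?orbT.
- exact: card_opoly_set.
Qed.

End Plane.

(** A Bezout coefficient [u] of [h] modulo [#|F|.-1] gives the inverse map: raising to the power
    [u]. *)
Lemma expr_inj (F : finFieldType) (h : nat) :
  (0 < h)%N -> coprime h #|F|.-1 -> injective (fun x : F => x ^+ h).
Proof.
move=> h_gt0 /(coprimeP _ h_gt0)[[u v] /= uv] x y /= xy.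
have uE : (h * u = (v * #|F|.-1).+1)%N.
  by move: (v * _)%N uv => w; rewrite (mulnC h); lia.
have E (t : F) : t ^+ (h * u) = t.
  (* One extra factor [t] is kept throughout, so each step uses [t ^+ #|F| = t], which also covers
     [t = 0]. *)
  rewrite uE; elim: v {uv uE} => [|v IH]; first by rewrite mul0n expr1.
  by rewrite mulSn -addnS exprD IH -exprSr prednK ?expf_card // (cardD1 0) inE.
by rewrite -(E x) -(E y) !exprM xy.
Qed.

Theorem theorem6p4 (F : finFieldType) (q m h : nat)
    (m_gt0 : (0 < m)%N) (q_def : q = (2 ^ m)%N) (cardF : #|F| = q)
    (h_gt0 : (0 < h)%N) (coprime_h : gcdn h (q - 1) = 1%N) :
  is_opoly ('X^h : {poly F}) <->
  (forall b1 b2 b3 : F, b1 != b2 -> b1 != b3 -> b2 != b3 ->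
     complete_sym (h%:Z - 2) b1 b2 b3 != 0).
Proof.
have inj : injective (horner ('X^h : {poly F})).
  move=> x y; rewrite !hornerXn; apply: expr_inj => //.
  by rewrite cardF -subn1 /coprime coprime_h.
rewrite (is_opolyP inj); split=> [det_neq0 x y z xy xz yz | S_neq0].
  by rewrite complete_sym_neq0 //; have := det_neq0 _ _ _ xy xz yz; rewrite !hornerXn.
move=> x y z xy xz yz; rewrite !hornerXn -complete_sym_neq0 //.
exact: S_neq0.
Qed.
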